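(* Let $p$ be a prime. Then for every $a \in \{p+1, \ldots, 3p\}$, there exists an $a$-element set $A \subseteq \mathbb{Z}_3 \times \mathbb{Z}_p$ with $$\mathrm{ST}(A) \le 21(a-p)^2.$$
   Context: For a subset $A$ of a finite abelian group, $\mathrm{ST}(A) = |\{(x,y,z) \in A^3 : x+y=z\}|$ is the number of (ordered) Schur triples contained in $A$ (elements not necessarily distinct). *)

(* Defs.v *)
From HB Require Import structures.
From mathcomp Require Import all_boot all_order all_fingroup all_algebra.
Set Implicit Arguments.
Unset Strict Implicit.
Unset Printing Implicit Defensive.

Import GRing.Theory.
Local Open Scope ring_scope.

(* The library equips a product with its finType and zmodType structures, but
   does not join them into a finZmodType. *)
HB.saturate prod.

Definition ST (G : finZmodType) (A : {set G}) : nat :=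
  #|[set t : G * G * G | [&& t.1.1 \in A, t.1.2 \in A, t.2 \in A
                            & t.1.1 + t.1.2 == t.2]]|.

(* Main.v *)
Require Import Defs.
From mathcomp Require Import all_boot all_order all_fingroup all_algebra.
From mathcomp Require Import zify.

(** Write a = p + t.  Every A has at most #|A| ^ 2 Schur triples, because a
    triple is determined by its two summands ([ST_le_sqr]), and (p + t) ^ 2 is
    at most 21 * t ^ 2 as soon as 2 * p <= 7 * t; any a-element set does then.

    Otherwise let k be the least integer with a <= 3 * k; now t is so small that
    2 * k <= p.  Let A be any a-element subset of Z_3 x [k, 2k).  Two residues
    in [k, 2k) can only sum into [k, 2k) by wrapping around p once, which forces
    both of them to lie in [p + 1 - k, 2k) ([band_summand]).  This interval has
    u = 3 * k - (p + 1) <= t + 1 elements (none if this is negative), so A has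
    at most (3 * u) ^ 2 Schur triples.

    For t >= 2 this is at most 9 * (t + 1) ^ 2 <= 21 * t ^ 2.  For t = 1 the
    bound u <= 2 would not be enough, but u = 2 happens only if 3 divides p,
    and then p = 3 was already covered by the first case. *)

Local Open Scope ring_scope.

Lemma ST_subset (G : finZmodType) (A B : {set G}) :
  A \subset B -> (ST A <= ST B)%N.
Proof.
move=> /subsetP sAB; apply/subset_leq_card/subsetP => t.
by rewrite !inE => /and4P[/sAB-> /sAB-> /sAB-> ->].
Qed.

(** The third entry of a Schur triple is the sum of the other two, so dropping
    it is injective and embeds the triples in B x B. *)
Lemma ST_le_sqr (G : finZmodType) (A B : {set G}) :
    (forall x y, x \in A -> y \in A -> x + y \in A -> x \in B /\ y \in B) ->
  (ST A <= #|B| ^ 2)%N.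
Proof.
move=> AB; rewrite /ST -mulnn -cardsX.
set T := [set t | _].
have injT : {in T &, injective (fun t : G * G * G => t.1)}.
  move=> [[x y] z] [[x' y'] z']; rewrite !inE /=.
  by move=> /and4P[_ _ _ /eqP<-] /and4P[_ _ _ /eqP<-] [-> ->].
rewrite -(card_in_imset injT); apply/subset_leq_card/subsetP => q.
move=> /imsetP[[[x y] z] xyzT ->]; move: xyzT; rewrite !inE /=.
move=> /and4P[xA yA zA /eqP xyz].
by rewrite -xyz in zA; have [-> ->] := AB x y xA yA zA.
Qed.

Lemma exists_subset_card (T : finType) (B : {set T}) (n : nat) :
  (n <= #|B|)%N -> exists2 A : {set T}, A \subset B & #|A| = n.
Proof.
move=> /card_geqP[s [us ss sB]]; exists [set x in s].
  by apply/subsetP => x; rewrite inE => /sB.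
by rewrite cardsE (card_uniqP us).
Qed.

Definition band (p m n : nat) : {set 'Z_3 * 'Z_p} :=
  [set g : 'Z_3 * 'Z_p | (m <= g.2 < n)%N].

Lemma card_Zp_itv (p m n : nat) :
  (1 < p)%N -> (n <= p)%N -> #|[set x : 'Z_p | (m <= x < n)%N]| = (n - m)%N.
Proof.
move=> p_gt1 le_np; rewrite cardsE cardE size_filter.
rewrite -(count_map (@nat_of_ord _) (fun i => m <= i < n)%N) -enumT val_enum_ord.
rewrite Zp_cast // -size_filter -[RHS](size_iota m).
apply/perm_size/uniq_perm; rewrite ?filter_uniq ?iota_uniq // => i.
by rewrite mem_filter !mem_iota; lia.
Qed.

Lemma card_band (p m n : nat) :
  (1 < p)%N -> (n <= p)%N -> #|band p m n| = (3 * (n - m))%N.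
Proof.
move=> p_gt1 le_np.
have -> : band p m n = setX [set: 'Z_3] [set x : 'Z_p | (m <= x < n)%N].
  by apply/setP => g; rewrite !inE.
by rewrite cardsX cardsT card_ord card_Zp_itv.
Qed.

(** Without reduction mod p the sum would be at least 2 * k, so it equals
    x.2 + y.2 - p; since that is at least k while each summand is less than
    2 * k, the other summand exceeds p - k. *)
Lemma band_summand (p k : nat) (x y : 'Z_3 * 'Z_p) :
    (1 < p)%N -> (2 * k <= p)%N ->
    x \in band p k (2 * k) -> y \in band p k (2 * k) ->
    x + y \in band p k (2 * k) ->
  x \in band p (p.+1 - k) (2 * k) /\ y \in band p (p.+1 - k) (2 * k).
Proof.
move=> p_gt1 le_2k_p; rewrite !inE /=.
move: (x.2 : nat) (y.2 : nat) => i j; rewrite (Zp_cast p_gt1) => ik jk.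
have [ltp|lep] := ltnP (i + j) p; first by rewrite modn_small //; lia.
have -> : ((i + j) %% p = i + j - p)%N.
  by rewrite -{1}(subnK lep) modnDr modn_small //; lia.
by lia.
Qed.

Lemma ST_band (p k : nat) :
    (1 < p)%N -> (2 * k <= p)%N ->
  (ST (band p k (2 * k)) <= (3 * (2 * k - (p.+1 - k))) ^ 2)%N.
Proof.
move=> p_gt1 le_2k_p; rewrite -(card_band _ _ _ p_gt1 le_2k_p).
by apply: ST_le_sqr => x y; apply: band_summand.
Qed.

(* For p prime, 'Z_p has exactly p elements. *)
Theorem proposition1p7 (p : nat) (p_prime : prime p) (a : nat)
    (a_range : (p + 1 <= a <= 3 * p)%N) :
  exists A : {set 'Z_3 * 'Z_p}, #|A| = a /\ (ST A <= 21 * (a - p) ^ 2)%N.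
Proof.
have p_gt1 := prime_gt1 p_prime.
have [large|small] := leqP (2 * p) (7 * (a - p)).
  have [|A _ cardA] := @exists_subset_card _ (band p 0 p) a.
    by rewrite card_band //; lia.
  exists A; split=> //; apply: (@leq_trans (a ^ 2)).
    by rewrite -cardA; apply: ST_le_sqr.
  by rewrite -!mulnn; nia.
pose k := ((a + 2) %/ 3)%N.
have [lo hi] : (a <= 3 * k)%N /\ (3 * k <= a + 2)%N by rewrite /k; lia.
have le_2k_p : (2 * k <= p)%N by lia.
have [|A sAB cardA] := @exists_subset_card _ (band p k (2 * k)) a.
  by rewrite card_band //; lia.
exists A; split=> //; apply: leq_trans (ST_subset _ _ _ sAB) _.
apply: leq_trans (ST_band _ _ p_gt1 le_2k_p) _.
have [t1|t_gt1] := leqP (a - p) 1.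
  (* Here p > 3, so 3 does not divide p and hence 3 * k <= p + 2. *)
  have ndvd3p : ~~ (3 %| p)%N by rewrite (dvdn_prime2 _ p_prime) //; lia.
  have u_le1 : (2 * k - (p.+1 - k) <= 1)%N by lia.
  by rewrite -!mulnn; nia.
have : (2 * k - (p.+1 - k) <= (a - p).+1)%N by lia.
move: (2 * k - _)%N (a - p)%N t_gt1 => u t t_gt1 le_ut.
by rewrite -!mulnn; nia.
Qed.
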